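(* Let $(\boldsymbol{\Sigma},\sigma)$ be a finitely primitive Markov subshift on the countable alphabet $\mathbb Z_+$, and let $A:\boldsymbol{\Sigma}\to\mathbb R$ be a bounded above, coercive and locally H\''older continuous potential. Then there exists an integer $\hat I > I_{\mathbb F}$ such that $$\beta_A=\max_{\mu\in\mathcal M_\sigma,\ \operatorname{supp}\mu\subseteq\Sigma_{\hat I}}\int A\,d\mu .$$ In particular, $A$-maximizing probabilities exist. Furthermore, there exists a compact $\sigma$-invariant set $\Omega\subseteq\Sigma_{\hat I}$ such that a measure $\mu\in\mathcal M_\sigma$ is $A$-maximizing if and only if $\operatorname{supp}\mu\subseteq\Omega$.
   Context: Let $\mathbf M:\mathbb Z_+\times\mathbb Z_+\to\{0,1\}$ be a transition matrix ($\mathbb Z_+$ = nonnegative integers). Put $\mathcal B_0=\{i:\mathbf M(i,j)=1\text{ for some }j\in\mathbb Z_+\}$ and $\mathcal B_n=\{i:\mathbf M(i,j)=1\text{ for some }j\in\mathcal B_{n-1}\}$ for $n>0$. $\mathbf M$ is primitive if there exist a subset $\mathbb F\subseteq\mathbb Z_+$ and an integer $K_0\ge 0$ such that for every pair $i,j\in\bigcap_{n\ge0}\mathcal B_n$ there are $\ell_1,\dots,\ell_{K_0}\in\mathbb F$ with $\mathbf M(i,\ell_1)\mathbf M(\ell_1,\ell_2)\cdots\mathbf M(\ell_{K_0},j)=1$; it is finitely primitive if moreover $\mathbb F$ is finite. $\boldsymbol{\Sigma}=\{\mathbf x=(x_0,x_1,\dots)\in\mathbb Z_+^{\mathbb Z_+}:\mathbf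 M(x_j,x_{j+1})=1\ \forall j\}$, with the metric $d(\mathbf x,\mathbf y)=\lambda^{k}$, $k=\min\{j:x_j\ne y_j\}$, for a fixed $\lambda\in(0,1)$; $\sigma$ is the left shift. The subshift is called (finitely) primitive if $\mathbf M$ is. $[i]=\{\mathbf x\in\boldsymbol\Sigma:x_0=i\}$. $\mathcal M_\sigma$ is the set of $\sigma$-invariant Borel probabilities on $\boldsymbol\Sigma$. For continuous bounded above $A$, $\beta_A=\sup_{\mu\in\mathcal M_\sigma}\int A\,d\mu$, and $\mu$ is $A$-maximizing if it attains this supremum. $\mathrm{Var}_k(A)=\sup\{A(\mathbf x)-A(\mathbf y): d(\mathbf x,\mathbf y)\le\lambda^k\}$; $A$ is locally H\''older continuous if there is $H_A>0$ with $\mathrm{Var}_k(A)\le H_A\lambda^k$ for all $k\ge1$. $A$ is coercive if $\lim_{i\to+\infty}\sup A|_{[i]}=-\infty$. For an integer $I\ge0$, $\Sigma_I=\{\mathbf x\in\{0,\dots,I\}^{\mathbb Z_+}:\mathbf M(x_j,x_{j+1})=1\ \forall j\}$ (a compact $\sigma$-invariant subset of $\boldsymbol\Sigma$). When $\mathbb F$ is finite, $I_{\mathbb F}=\max\mathbb F$. *)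

(* Defs.v *)
From mathcomp Require Import all_boot all_order all_algebra all_classical all_reals all_analysis.
Set Implicit Arguments. Unset Strict Implicit. Unset Printing Implicit Defensive.
Import Order.TTheory GRing.Theory Num.Theory.
Local Open Scope classical_set_scope.
Local Open Scope ring_scope.

Definition trans_matrix := nat -> nat -> bool.

Fixpoint Bset (M : trans_matrix) (n : nat) : set nat :=
  match n with
  | 0 => [set i | exists j, M i j]
  | n'.+1 => [set i | exists j, Bset M n' j /\ M i j]
  end.

Definition Bcap (M : trans_matrix) : set nat := [set i | forall n, Bset M n i].

Definition finitely_primitive_with (M : trans_matrix) (F : seq nat) (K0 : nat) :=
  forall i j, Bcap M i -> Bcap M j ->
    exists l : seq nat, [/\ size l = K0, all (fun a => a \in F) l &
                            path M i (rcons l j)].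

Definition I_F (F : seq nat) : nat := \max_(a <- F) a.

Definition Sigma (M : trans_matrix) : set (nat -> nat) :=
  [set x | forall j, M (x j) (x j.+1)].

Definition sshift (x : nat -> nat) : nat -> nat := fun j => x j.+1.

Definition SigmaI (M : trans_matrix) (I : nat) : set (nat -> nat) :=
  [set x | Sigma M x /\ forall j, (x j <= I)%N].

(* cylinder of length k around x = closed ball of radius lambda^k for d *)
Definition cyl (x : nat -> nat) (k : nat) : set (nat -> nat) :=
  [set y | forall j, (j < k)%N -> y j = x j].

Definition cylinders : set (set (nat -> nat)) :=
  [set C | exists x k, C = cyl x k].

(* nat^nat with the sigma-algebra generated by cylinders, i.e. the Borel
   sigma-algebra of the (product) topology of d. *)
Definition PS := g_sigma_algebraType cylinders.

(* sigma-invariant Borel probabilities on Sigma, seen as probabilities on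
   nat^nat giving full mass to the (Borel) set Sigma. *)
Definition invariant_prob (R : realType) (M : trans_matrix)
  (mu : probability PS R) : Prop :=
  mu (Sigma M : set PS) = 1%E /\
  forall B : set PS, measurable B -> mu (sshift @^-1` B) = mu B.

(* topological support: points all of whose (basic) neighbourhoods,
   i.e. cylinders, have positive measure *)
Definition supp (R : realType) (mu : probability PS R) : set (nat -> nat) :=
  [set x | forall k, (0 < mu (cyl x k : set PS))%E].

Definition intA (R : realType) (M : trans_matrix) (A : (nat -> nat) -> R)
  (mu : probability PS R) : \bar R :=
  (\int[mu]_(x in (Sigma M : set PS)) (A x)%:E)%E.

Definition betaA (R : realType) (M : trans_matrix) (A : (nat -> nat) -> R) : \bar R :=
  ereal_sup [set intA M A mu | mu in [set mu : probability PS R | invariant_prob M mu]].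

Definition maximizing (R : realType) (M : trans_matrix) (A : (nat -> nat) -> R)
  (mu : probability PS R) : Prop :=
  invariant_prob M mu /\ intA M A mu = betaA M A.

Definition bounded_above_on (R : realType) (M : trans_matrix) (A : (nat -> nat) -> R) :=
  exists C : R, forall x, Sigma M x -> A x <= C.

Definition coercive (R : realType) (M : trans_matrix) (A : (nat -> nat) -> R) :=
  forall K : R, exists N : nat, forall i, (N <= i)%N ->
    forall x, Sigma M x -> x 0%N = i -> A x <= K.

(* Var_k(A) <= H lambda^k for all k >= 1, where d(x,y) <= lambda^k iff
   x and y agree on their first k coordinates. *)
Definition locally_Holder (R : realType) (M : trans_matrix) (lambda : R)
  (A : (nat -> nat) -> R) :=
  exists H : R, 0 < H /\
    forall k : nat, (1 <= k)%N -> forall x y, Sigma M x -> Sigma M y ->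
      (forall j, (j < k)%N -> x j = y j) -> A x - A y <= H * lambda ^+ k.

(* Main.v *)
Require Import Defs.
From HB Require Import structures.
From mathcomp Require Import all_boot all_order all_algebra all_classical all_reals all_analysis.
From mathcomp Require Import measurable_realfun lra.
Set Implicit Arguments. Unset Strict Implicit. Unset Printing Implicit Defensive.
Import Order.TTheory GRing.Theory Num.Theory.
Import numFieldNormedType.Exports.
Local Open Scope classical_set_scope.
Local Open Scope ring_scope.

(* Let c be the supremum of the averages of A over periodic orbits, and let u(x)
   be the supremum of S_n A(y) - n c over all n and all y with sigma^n y = x.
   Finite primitivity closes any orbit segment into a periodic orbit at bounded
   cost, so u is bounded; it is uniformly continuous, and
   g = c - A - u + u o sigma >= 0.  Integrating g gives int A dmu <= c for every
   invariant mu, with equality exactly when supp mu lies in the contact set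
   Omega of points on whose whole forward orbit g vanishes.  As u is bounded,
   coercivity bounds the letters occurring in Omega, which is therefore compact.
   Periodic orbits with averages close to c have long runs on which g is small;
   a limit of such runs is a point z of Omega.  The frequencies of words along
   the orbit of z, taken along an ultrafilter, define an invariant probability
   carried by Omega, so that c = beta_A. *)

Definition sh (k : nat) (x : nat -> nat) : nat -> nat := fun j => x (k + j)%N.

Definition agree (k : nat) (x y : nat -> nat) :=
  forall j, (j < k)%N -> x j = y j.

Definition birk {R : realType} (f : (nat -> nat) -> R) n (x : nat -> nat) : R :=
  \sum_(k < n) f (sh k x).

Lemma sh0 x : sh 0 x = x.
Proof. by []. Qed.

Lemma shD a b x : sh a (sh b x) = sh (b + a) x.
Proof. by apply/funext => j; rewrite /sh addnA. Qed.

Lemma sh1 x : sh 1 x = sshift x.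
Proof. by []. Qed.

Lemma sshift_sh k x : sshift (sh k x) = sh k.+1 x.
Proof. by rewrite -sh1 shD addn1. Qed.

Lemma Sigma_sh M k x : Sigma M x -> Sigma M (sh k x).
Proof. by move=> Mx j; rewrite /sh addnS; exact: Mx. Qed.

Lemma Sigma_sshift M x : Sigma M x -> Sigma M (sshift x).
Proof. exact: (@Sigma_sh M 1). Qed.

Lemma birk0 {R : realType} (f : (nat -> nat) -> R) x : birk f 0 x = 0.
Proof. by rewrite /birk big_ord0. Qed.

Lemma birkSl {R : realType} (f : (nat -> nat) -> R) n x :
  birk f n.+1 x = f x + birk f n (sshift x).
Proof. by rewrite /birk big_ord_recl. Qed.

Lemma birkD {R : realType} (f : (nat -> nat) -> R) m n x :
  birk f (m + n) x = birk f m x + birk f n (sh m x).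
Proof.
rewrite /birk big_split_ord /=; congr (_ + _).
by apply: eq_bigr => i _; rewrite shD.
Qed.

Lemma birk_blocks {R : realType} (f : (nat -> nat) -> R) N n x :
  birk f (N * n) x = \sum_(k < n) birk f N (sh (N * k) x).
Proof.
elim: n => [|n IH]; first by rewrite muln0 birk0 big_ord0.
by rewrite mulnS addnC birkD IH big_ord_recr.
Qed.

Lemma birk_periodic {R : realType} (f : (nat -> nat) -> R) N n x :
  sh n x = x -> birk f (n * N) x = birk f n x *+ N.
Proof.
move=> per; rewrite birk_blocks.
have perk k : sh (n * k) x = x.
  by elim: k => [|k IH]; rewrite ?muln0// mulnS -shD per.
by under eq_bigr do rewrite perk; rewrite sumr_const card_ord.
Qed.

Lemma Sigma_Bcap M x j : Sigma M x -> Bcap M (x j).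
Proof.
move=> Mx n; elim: n j => [|n IH] j /=; first by exists (x j.+1).
by exists (x j.+1).
Qed.

Lemma Sigma_cycle M w : (0 < size w)%N -> cycle M w ->
  Sigma M (fun j => nth 0%N w (j %% size w)).
Proof.
case: w => // a s _ /= /(pathP 0%N); rewrite size_rcons => H j /=.
set q := (size s).+1; have jq : (j %% q < q)%N by rewrite ltn_mod.
have := H _ jq; rewrite -rcons_cons nth_rcons /= -/q jq.
rewrite nth_rcons; case: ltngtP => [jlt|jgt|jeq].
- have -> : (j.+1 %% q = (j %% q).+1)%N.
    by rewrite -addn1 -modnDml addn1 modn_small// ltnS.
  by [].
- by move: jq; rewrite /q ltnS leqNgt jgt.
- have -> : (j.+1 %% q = 0)%N by rewrite -addn1 -modnDml addn1 jeq modnn.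
  by [].
Qed.

Lemma closing M F K0 y n : finitely_primitive_with M F K0 -> Sigma M y ->
  (0 < n)%N -> exists p, [/\ Sigma M p, sh (n + K0) p = p, agree n p y &
    forall i, (i < K0)%N -> p (n + i)%N \in F].
Proof.
move=> fp My; case: n => // n _.
have [l [sl lF pl]] := fp _ _ (Sigma_Bcap n My) (Sigma_Bcap 0 My).
pose w := mkseq y n.+1 ++ l.
have sw : size w = (n.+1 + K0)%N by rewrite size_cat size_mkseq sl.
have nw i : (i < n.+1 + K0)%N ->
    nth 0%N w i = if (i < n.+1)%N then y i else nth 0%N l (i - n.+1).
  move=> _; rewrite nth_cat size_mkseq; case: ifP => // ilt.
  by rewrite nth_mkseq.
exists (fun j => nth 0%N w (j %% size w)); split.
- apply: Sigma_cycle; first by rewrite sw.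
  have -> : w = y 0%N :: (mkseq (fun j => y j.+1) n ++ l).
    by rewrite /w /mkseq /= (iotaDl 1 0 n) -map_comp.
  rewrite /= rcons_cat cat_path; apply/andP; split.
    apply/(pathP 0%N) => i; rewrite size_mkseq => ilt.
    rewrite nth_mkseq//; case: i ilt => [|i] ilt /=; first exact: My.
    by rewrite nth_mkseq ?(ltnW ilt)//; exact: My.
  rewrite (_ : last _ _ = y n)//.
  rewrite (last_nth 0%N) size_mkseq; case: (n) => [|m]//=.
  by rewrite nth_mkseq.
- apply/funext => j; rewrite /sh sw.
  by rewrite modnDl.
- move=> j jn; rewrite sw modn_small; last by rewrite ltn_addr.
  by rewrite nw ?jn// ltn_addr.
- move=> i iK; rewrite sw modn_small ?ltn_add2l// nw ?ltn_add2l//.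
  rewrite ltnNge leq_addr /= addKn.
  by move/allP: lF; apply; rewrite mem_nth// sl.
Qed.

Definition splice n (y x : nat -> nat) : nat -> nat :=
  fun j => if (j < n)%N then y j else x (j - n)%N.

Lemma sh_splice n y x : sh n (splice n y x) = x.
Proof. by apply/funext => j; rewrite /sh /splice ltnNge leq_addr /= addKn. Qed.

Lemma Sigma_splice M n y x : Sigma M y -> Sigma M x -> y n = x 0%N ->
  Sigma M (splice n y x).
Proof.
move=> My Mx yx j; rewrite /splice.
have [jn|jn|jn] := ltngtP j.+1 n.
- exact: My.
- by rewrite subSn//; exact: Mx.
- by rewrite -jn subnn -yx -jn; exact: My.
Qed.

(* Uniform continuity on Sigma for the metric d: agreeing on the first k
   coordinates means being at distance at most lambda^k. *)
Definition ucont {R : realType} M (f : (nat -> nat) -> R) :=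
  forall e, 0 < e -> exists k, forall x y, Sigma M x -> Sigma M y ->
    agree k x y -> f x - f y <= e.

Lemma agree_sym k x y : agree k x y -> agree k y x.
Proof. by move=> H j jk; rewrite H. Qed.

Lemma agree_le k m x y : (k <= m)%N -> agree m x y -> agree k x y.
Proof. by move=> km H j jk; apply: H; apply: leq_trans km. Qed.

Lemma agree_sh k m x y : agree (k + m) x y -> agree m (sh k x) (sh k y).
Proof. by move=> H j jm; apply: H; rewrite ltn_add2l. Qed.

Lemma ucontD {R : realType} M (f h : (nat -> nat) -> R) :
  ucont M f -> ucont M h -> ucont M (fun x => f x + h x).
Proof.
move=> cf ch e e0; have e2 : 0 < e / 2 by rewrite divr_gt0.
have [k fk] := cf _ e2; have [m hm] := ch _ e2.
exists (maxn k m) => x y Mx My xy.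
have := fk _ _ Mx My (agree_le (leq_maxl _ _) xy).
have := hm _ _ Mx My (agree_le (leq_maxr _ _) xy).
lra.
Qed.

Lemma ucontN {R : realType} M (f : (nat -> nat) -> R) :
  ucont M f -> ucont M (fun x => - f x).
Proof.
move=> cf e e0; have [k fk] := cf _ e0; exists k => x y Mx My /agree_sym xy.
by rewrite opprK addrC; exact: fk.
Qed.

Lemma ucont_cst {R : realType} M (c : R) : ucont M (fun=> c).
Proof. by move=> e e0; exists 0%N => x y _ _ _; rewrite subrr ltW. Qed.

Lemma ucont_sshift {R : realType} M (f : (nat -> nat) -> R) :
  ucont M f -> ucont M (fun x => f (sshift x)).
Proof.
move=> cf e e0; have [k fk] := cf _ e0; exists k.+1 => x y Mx My xy.
by apply: fk; [exact: Sigma_sshift..|exact: (@agree_sh 1)].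
Qed.

Lemma geometric_small {R : realType} (l H e : R) : 0 < l < 1 -> 0 < e ->
  exists k, (0 < k)%N /\ l ^+ k * H <= e.
Proof.
move=> /andP[l0 l1] e0.
have : (fun n => l ^+ n * H) @ \oo --> 0 * H.
  by apply: cvgM; [apply: cvg_expr; rewrite gtr0_norm|exact: cvg_cst].
rewrite mul0r => /cvgrPdist_lt /(_ _ e0) [N _ HN].
exists N.+1; split=> //; have := HN N.+1 (leqnSn N).
by rewrite /= sub0r normrN => /ltW; apply: le_trans; exact: ler_norm.
Qed.

(** * A bounded sub-action *)

Section SubAction.
Variables (R : realType) (M : trans_matrix) (F : seq nat) (K0 : nat) (l : R)
  (A : (nat -> nat) -> R) (H : R).
Hypotheses (l01 : 0 < l < 1) (fp : finitely_primitive_with M F K0)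
  (S0 : Sigma M !=set0) (bnd : bounded_above_on M A) (H0 : 0 < H)
  (varA : forall k : nat, (1 <= k)%N -> forall x y, Sigma M x -> Sigma M y ->
      (forall j, (j < k)%N -> x j = y j) -> A x - A y <= H * l ^+ k).

Let D := H / (1 - l).

Let D0 : 0 <= D.
Proof. by case/andP: l01 => l0 l1; rewrite divr_ge0 ?subr_ge0 ?ltW. Qed.

Lemma birk_distortion n m x y : Sigma M x -> Sigma M y -> agree (n + m) x y ->
  birk A n x - birk A n y <= l ^+ m * D.
Proof.
case/andP: l01 => l0 l1.
suff geo : Sigma M x -> Sigma M y -> agree (n + m) x y ->
    birk A n x - birk A n y <= l ^+ m * D * (1 - l ^+ n).
  move=> Mx My xy; apply: le_trans (geo Mx My xy) _.
  have lm0 : 0 <= l ^+ m * D by rewrite mulr_ge0// exprn_ge0// ltW.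
  have ln0 : 0 <= l ^+ n by rewrite exprn_ge0// ltW.
  by rewrite ler_piMr//; lra.
elim: n x y => [|n IH] x y Mx My xy; first by rewrite !birk0 expr0; lra.
rewrite !birkSl.
have := IH _ _ (Sigma_sshift Mx) (Sigma_sshift My) (@agree_sh 1 _ _ _ xy).
have := @varA (n.+1 + m)%N isT _ _ Mx My xy.
have -> : H = D * (1 - l) by rewrite /D divfK// subr_eq0 gt_eqF.
rewrite exprD exprS.
have : 0 <= D * l ^+ n * l ^+ m * (1 - l) ^+ 2.
  by rewrite mulr_ge0 ?sqr_ge0// -mulrA mulr_ge0// mulr_ge0// exprn_ge0// ltW.
move: (l ^+ n) (l ^+ m) (birk _ _ _) (birk _ _ _) => a b s t; lra.
Qed.

Lemma F_lower_bound : exists2 C', 0 <= C' &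
  forall x, Sigma M x -> x 0%N \in F -> - C' <= A x.
Proof.
elim: F => [|a s [C' C'0 HC']]; first by exists 0.
have [[y [My ya]]|noy] := pselect (exists y, Sigma M y /\ y 0%N = a).
  have Hl : 0 <= H * l by rewrite mulr_ge0// ?ltW//; case/andP: l01.
  exists (C' + `|A y| + H * l); first by rewrite !addr_ge0.
  move=> x Mx; rewrite inE => /orP[/eqP xa|xs]; last first.
    by have := HC' _ Mx xs; have := normr_ge0 (A y); lra.
  have : A y - A x <= H * l.
    rewrite -[l]expr1; apply: varA => // -[|//] _; by rewrite ya xa.
  by have := ler_norm (- A y); rewrite normrN; lra.
exists C' => // x Mx; rewrite inE => /orP[/eqP xa|xs]; last exact: HC'.
by case: noy; exists x.
Qed.

Definition periodic_averages : set R :=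
  [set r | exists p n, [/\ (0 < n)%N, Sigma M p, sh n p = p &
                         r = birk A n p / n%:R]].

Let c := sup periodic_averages.

Lemma has_sup_periodic_averages : has_sup periodic_averages.
Proof.
split.
  have [y My] := S0; have [p [Mp per _ _]] := closing fp My (ltn0Sn 0).
  by exists (birk A (1 + K0) p / (1 + K0)%:R), p, (1 + K0)%N.
have [C HC] := bnd; exists C => _ [p [n [n0 Mp _ ->]]].
rewrite ler_pdivrMr ?ltr0n// mulr_natr -[n in C *+ n]card_ord -sumr_const.
by apply: ler_sum => i _; exact/HC/Sigma_sh.
Qed.

Lemma birk_periodic_le p n : Sigma M p -> sh n p = p -> birk A n p <= n%:R * c.
Proof.
case: n => [|n] Mp per; first by rewrite birk0 mul0r.
rewrite mulrC -ler_pdivrMr ?ltr0n//; apply: ub_le_sup.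
  by case: has_sup_periodic_averages.
by exists p, n.+1.
Qed.

Lemma birk_bounded : exists2 C, 0 <= C &
  forall n y, Sigma M y -> birk A n y - n%:R * c <= C.
Proof.
have [C' C'0 HC'] := F_lower_bound.
have K0C : 0 <= K0%:R * C' by rewrite mulr_ge0.
have K0c : 0 <= K0%:R * `|c| by rewrite mulr_ge0.
exists (D + K0%:R * C' + K0%:R * `|c|); first by rewrite !addr_ge0.
case=> [|n] y My; first by rewrite birk0 mul0r subr0 !addr_ge0.
have [p [Mp per py pF]] := closing fp My (ltn0Sn n).
have h1 : birk A n.+1 y - birk A n.+1 p <= D.
  rewrite -[D]mul1r -(expr0 l); apply: birk_distortion => //.
  by rewrite addn0; exact: agree_sym.
have := birk_periodic_le Mp per; rewrite birkD natrD mulrDl => h2.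
have h3 : - (K0%:R * C') <= birk A K0 (sh n.+1 p).
  rewrite -mulrN mulrC mulr_natr -[K0 in - C' *+ K0]card_ord -sumr_const.
  apply: ler_sum => i _; apply: HC'; first exact/Sigma_sh/Sigma_sh.
  by rewrite /sh addn0; exact: pF.
have h4 : K0%:R * c <= K0%:R * `|c| by rewrite ler_wpM2l// ler_norm.
lra.
Qed.

Definition preimage_sums (x : nat -> nat) : set R :=
  [set s | exists n y, [/\ Sigma M y, sh n y = x & s = birk A n y - n%:R * c]].

Let u x := sup (preimage_sums x).

Lemma has_sup_preimage_sums x : Sigma M x -> has_sup (preimage_sums x).
Proof.
move=> Mx; split; first by exists (birk A 0 x - 0%:R * c), 0%N, x.
by have [C _ HC] := birk_bounded; exists C => _ [n [y [My _ ->]]]; exact: HC.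
Qed.

Lemma subaction_ge n y : Sigma M y -> birk A n y - n%:R * c <= u (sh n y).
Proof.
move=> My; apply: ub_le_sup; last by exists n, y.
by case: (has_sup_preimage_sums (Sigma_sh n My)).
Qed.

Lemma subaction_le x r : Sigma M x ->
  (forall n y, Sigma M y -> sh n y = x -> birk A n y - n%:R * c <= r) ->
  u x <= r.
Proof.
move=> Mx h; apply: ge_sup; first by case: (has_sup_preimage_sums Mx).
by move=> _ [n [y [My yx ->]]]; exact: h.
Qed.

Lemma subaction_ucont : ucont M u.
Proof.
move=> e e0; have [k [k0 ke]] := geometric_small D l01 e0.
exists k => x x' Mx Mx' xx'; rewrite lerBlDr; apply: subaction_le => // n y My yx.
have yn : y n = x' 0%N by rewrite -(xx' _ k0) -yx /sh addn0.
have My' := Sigma_splice My Mx' yn.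
have := subaction_ge n My'; rewrite sh_splice => h.
suff : birk A n y - birk A n (splice n y x') <= l ^+ k * D by lra.
apply: birk_distortion => // j jnk; rewrite /splice; case: ltnP => // nj.
rewrite -[in LHS](subnKC nj) -[y _]/(sh n y (j - n)%N) yx; apply: xx'.
by rewrite ltn_subLR.
Qed.

Lemma bounded_subaction_exists : exists (c : R) (u : (nat -> nat) -> R) (C : R),
  [/\ forall x, Sigma M x -> 0 <= u x <= C, ucont M u,
      forall x, Sigma M x -> A x + u x <= c + u (sshift x) &
      forall e, 0 < e -> exists p n, [/\ (0 < n)%N, Sigma M p, sh n p = p &
        n%:R * c - birk A n p <= n%:R * e]].
Proof.
have [C C0 HC] := birk_bounded.
exists c, u, C; split.
- move=> x Mx; apply/andP; split.
    by have := subaction_ge 0 Mx; rewrite birk0 mul0r subr0.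
  by apply: subaction_le => // n y My _; exact: HC.
- exact: subaction_ucont.
- move=> x Mx; rewrite -lerBrDl; apply: subaction_le => // n y My yx.
  have := subaction_ge n.+1 My; rewrite -sshift_sh yx.
  by rewrite -[n.+1]addn1 birkD yx birkSl birk0 natrD; lra.
- move=> e e0; have := sup_adherent e0 has_sup_periodic_averages.
  case=> _ [p [n [n0 Mp per ->]]] h; exists p, n; split=> //.
  have n0' : 0 < n%:R :> R by rewrite ltr0n.
  move: h; rewrite ltr_pdivlMr// -/c => h.
  by rewrite lerBlDr -lerBlDl -mulrBr mulrC ltW.
Qed.

End SubAction.

Lemma Holder_ucont {R : realType} M (l : R) A : 0 < l < 1 ->
  locally_Holder M l A -> ucont M A.
Proof.
move=> l01 [H [H0 varA]] e e0; have [k [k0 ke]] := geometric_small H l01 e0.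
exists k => x y Mx My xy; apply: le_trans (varA _ k0 _ _ Mx My xy) _.
by rewrite mulrC.
Qed.

(** * The contact set *)

Lemma ultra_finite (T : Type) (U : set_system T) (f : T -> nat) I : UltraFilter U ->
  U [set N | (f N <= I)%N] -> exists a, U [set N | f N = a].
Proof.
move=> UU; elim: I => [|I IH] fI.
  by exists 0%N; apply: filterS fI => N /=; rewrite leqn0 => /eqP.
have [h|h] := in_ultra_setVsetC [set N | f N = I.+1] UU; first by exists I.+1.
apply: IH; apply: filterS2 fI h => N /= h1 h2.
by rewrite -ltnS ltn_neqAle; apply/andP; split=> //; exact/eqP.
Qed.

Lemma ultra_limit (T : Type) (U : set_system T) (z : T -> nat -> nat) :
  UltraFilter U -> (forall i, exists I, U [set t | (z t i <= I)%N]) ->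
  exists p, forall k, U [set t | agree k (z t) p].
Proof.
move=> UU bz.
have ex i : exists a, U [set t | z t i = a].
  by have [I UI] := bz i; exact: ultra_finite UI.
have [p Hp] := choice ex; exists p; elim=> [|k IH].
  by apply: (filterS _ filterT) => t _ j.
apply: filterS2 IH (Hp k) => t h1 h2 j.
by rewrite ltnS leq_eqVlt => /orP[/eqP ->|/h1].
Qed.

Section Contact.
Variables (R : realType) (M : trans_matrix) (g : (nat -> nat) -> R).
Hypotheses (cg : ucont M g) (g0 : forall x, Sigma M x -> 0 <= g x).

Definition contact : set (nat -> nat) :=
  [set x | Sigma M x /\ forall k, g (sh k x) = 0].

Lemma contact_limit p :
  (forall k e, 0 < e -> exists x, [/\ Sigma M x, agree k x p &
     forall j, (j < k)%N -> g (sh j x) <= e]) -> contact p.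
Proof.
move=> H; have Mp : Sigma M p.
  move=> j; have [x [Mx xp _]] := H j.+2 1 ltr01.
  by rewrite -!xp//; exact: Mx.
split=> // k; apply/eqP; rewrite eq_le g0 ?andbT; last exact: Sigma_sh.
apply/ler_addgt0Pl => e e0; rewrite addr0.
have e2 : 0 < e / 2 by rewrite divr_gt0.
have [m Hm] := cg e2.
have [x [Mx xp gx]] := H (k.+1 + m)%N _ e2.
have := gx k (leq_addr _ _).
have km : (k + m <= k.+1 + m)%N by rewrite leq_add2r.
have := Hm _ _ (Sigma_sh k Mp) (Sigma_sh k Mx)
  (agree_sh (agree_sym (agree_le km xp))).
lra.
Qed.

Lemma contact_closed p :
  (forall k, exists x, contact x /\ agree k x p) -> contact p.
Proof.
move=> H; apply: contact_limit => k e e0; have [x [[Mx gx] xp]] := H k.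
by exists x; split=> // j _; rewrite gx ltW.
Qed.

Lemma contact_sshift x : contact x -> contact (sshift x).
Proof.
move=> [Mx gx]; split; first exact: Sigma_sshift.
by move=> k; rewrite -sh1 shD.
Qed.

Variable I : nat.
Hypothesis gI : forall x, Sigma M x -> g x < 1 -> (x 0%N <= I)%N.

Lemma contact_SigmaI : contact `<=` SigmaI M I.
Proof.
move=> x [Mx gx]; split=> // j.
by have := gI (Sigma_sh j Mx); rewrite gx /sh addn0; apply.
Qed.

Lemma contact_nonempty :
  (forall N e, 0 < e -> exists x, Sigma M x /\
     forall j, (j < N)%N -> g (sh j x) <= e) -> contact !=set0.
Proof.
move=> H.
have ex (N : nat) : exists x, Sigma M x /\
    forall j, (j < N)%N -> g (sh j x) <= N.+1%:R^-1.
  by apply: H; rewrite invr_gt0.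
have [z Hz] := choice ex.
have [U [UU ooU]] := ultraFilterLemma eventually_filter.
have Ult i : U [set N | (i < N)%N] by apply: ooU; exists i.+1.
have [p Hp] : exists p, forall k, U [set t | agree k (z t) p].
  apply: ultra_limit => i; exists I; apply: filterS (Ult i) => N /= iN.
  have [Mz gz] := Hz N.
  have := gI (Sigma_sh i Mz); rewrite /sh addn0; apply.
  apply: le_lt_trans (gz _ iN) _.
  by rewrite invf_lt1 ?ltr0n// ltr1n ltnS; exact: leq_ltn_trans iN.
exists p; apply: contact_limit => k e e0.
have Ue : U [set N : nat | N.+1%:R^-1 <= e].
  apply: ooU; have := near_infty_natSinv_lt (PosNum e0).
  by apply: filterS => N /ltW.
have /filter_ex[N [/= zp [kN Ne]]] : U ([set t | agree k (z t) p] `&`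
    ([set N | (k < N)%N] `&` [set N : nat | N.+1%:R^-1 <= e])).
  by apply: filterI (Hp k) _; exact: filterI.
have [Mz gz] := Hz N.
exists (z N); split=> // j jk; apply: le_trans Ne; apply: gz.
exact: ltn_trans kN.
Qed.

Lemma contact_compact : compact (contact : set {ptws nat -> nat}).
Proof.
rewrite compact_ultra => U UU UO.
have [p Hp] : exists p, forall k, U [set x | agree k x p].
  apply: (@ultra_limit _ U id) => i; exists I.
  by apply: filterS UO => x /contact_SigmaI [_]; exact.
exists p; split.
  apply: contact_closed => k.
  have /filter_ex[x [? ?]] : U (contact `&` [set x | agree k x p]).
    exact: filterI.
  by exists x.
apply/cvg_sup => i; apply/cvg_image.
  rewrite predeqE => a; split=> // _; by exists (fun=> a).
move=> B Bp; exists (fun x => B (x i)) => /=.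
  apply: filterS (Hp i.+1) => x /= /(_ i (ltnSn i)) ->; exact: nbhs_singleton.
rewrite predeqE => a; split=> [[x Bx <-]//|Ba]; by exists (fun=> a).
Qed.

End Contact.

Lemma birk_cobound {R : realType} (A u : (nat -> nat) -> R) (c : R) n x :
  birk (fun x => c - A x - u x + u (sshift x)) n x =
  n%:R * c - birk A n x - u x + u (sh n x).
Proof.
elim: n x => [|n IH] x; first by rewrite !birk0 sh0; lra.
rewrite !birkSl IH -sh1 shD [in n.+1%:R]mulrSr add1n; lra.
Qed.

(* Blocks of length N tile N periods of the orbit, so one of them has at most
   the average sum. *)
Lemma small_run {R : realType} (g : (nat -> nat) -> R) M n p N (e : R) :
  (forall x, Sigma M x -> 0 <= g x) -> (0 < n)%N -> Sigma M p -> sh n p = p ->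
  0 < e -> birk g n p <= n%:R * (e / N.+1%:R) ->
  exists x, Sigma M x /\ forall j, (j < N)%N -> g (sh j x) <= e.
Proof.
move=> g0 n0 Mp per e0 gn; apply: contrapT => no.
have big k : e <= birk g N (sh k p).
  rewrite leNgt; apply/negP => small; apply: no; exists (sh k p).
  split=> [|j jN]; first exact: Sigma_sh.
  apply: le_trans (ltW small); rewrite /birk (bigD1 (Ordinal jN))//= lerDl.
  by apply: sumr_ge0 => i _; apply: g0; exact/Sigma_sh/Sigma_sh.
have := birk_periodic g N per; rewrite mulnC birk_blocks => E.
have : n%:R * e <= birk g n p *+ N.
  rewrite -E mulr_natl -[n in X in X <= _]card_ord -sumr_const.
  by apply: ler_sum => i _.
apply/negP; rewrite -ltNge -[_ *+ N]mulr_natr.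
have Npos : 0 < N.+1%:R :> R by rewrite ltr0n.
apply: (@le_lt_trans _ _ (n%:R * (e / N.+1%:R) * N%:R)).
  by rewrite ler_wpM2r.
rewrite -mulrA ltr_pM2l ?ltr0n// mulrAC -mulrA gtr_pMr//.
by rewrite ltr_pdivrMr// mul1r ltr_nat.
Qed.

(** * Invariant measures and the contact set *)

Lemma cyl_self x k : cyl x k x.
Proof. by []. Qed.

Lemma cyl_prefix x k : cyl (nth 0%N (mkseq x k)) k = cyl x k.
Proof.
by apply/seteqP; split=> y yx j jk; have := yx j jk; rewrite nth_mkseq.
Qed.

Lemma measurable_cyl x k : measurable (cyl x k : set PS).
Proof. by apply: sub_sigma_algebra; exists x, k. Qed.

Lemma open_bigcup_cyl (B : set (nat -> nat)) :
  (forall x, B x -> exists k, cyl x k `<=` B) ->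
  B = \bigcup_(s : seq nat)
    (if `[< cyl (nth 0%N s) (size s) `<=` B >]
     then cyl (nth 0%N s) (size s) else set0).
Proof.
move=> oB; apply/seteqP; split=> [x /oB[k kB]|x [s _]]; last first.
  by case: asboolP => // sB; exact: sB.
exists (mkseq x k) => //; rewrite size_mkseq cyl_prefix.
by case: asboolP => // _; exact: cyl_self.
Qed.

Lemma open_measurable_PS (B : set PS) :
  (forall x, B x -> exists k, cyl x k `<=` B) -> measurable B.
Proof.
move=> /open_bigcup_cyl ->.
apply: countable_bigcupT_measurable => // s.
by case: ifP => _; [exact: measurable_cyl|exact: measurable0].
Qed.

Lemma Sigma_setC_open M x : (~` Sigma M) x ->
  exists k, cyl x k `<=` ~` Sigma M.
Proof.
move=> nMx; apply: contrapT => H; apply: nMx => j.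
apply: contrapT => nM; apply: H; exists j.+2 => y yx My; apply: nM.
by rewrite -!yx//; exact: My.
Qed.

Lemma measurable_Sigma M : measurable (Sigma M : set PS).
Proof.
rewrite -[Sigma M]setCK; apply: measurableC.
by apply: open_measurable_PS => x; exact: Sigma_setC_open.
Qed.

Lemma measurable_ucont {R : realType} M (f : (nat -> nat) -> R) :
  ucont M f -> measurable_fun (Sigma M : set PS) (f : PS -> R).
Proof.
move=> cf mD; apply: (measurability _ (RGenOInfty.measurableE R)) => //.
move=> _ [_ [a ->] <-].
have -> : (Sigma M : set PS) `&` f @^-1` `]a, +oo[%classic =
    Sigma M `&` [set y | exists x, exists k, [/\ cyl x k y &
      forall z, Sigma M z -> cyl x k z -> a < f z]].
  apply/seteqP; split=> [x [Mx /=]|y [My [x [k [xy H]]]]]; last first.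
    by split=> //=; rewrite in_itv/= andbT; exact: H.
  rewrite in_itv/= andbT => ax; split=> //.
  have e0 : 0 < (f x - a) / 2 by rewrite divr_gt0// subr_gt0.
  have [k Hk] := cf _ e0; exists x, k; split=> // z Mz xz.
  have := Hk _ _ Mx Mz (agree_sym xz); lra.
apply: measurableI => //; apply: open_measurable_PS => y [x [k [xy H]]].
exists k => z yz; exists x, k; split=> // j jk.
by rewrite yz// xy.
Qed.

Lemma measurable_sshift : measurable_fun [set: PS] (sshift : PS -> PS).
Proof.
apply: (@measurability _ _ PS PS _ _ cylinders) => //.
move=> _ [_ [x [k ->]] <-]; rewrite setTI; apply: open_measurable_PS => y xy.
by exists k.+1 => z yz j jk; rewrite -xy// /sshift yz.
Qed.

Lemma le_integral_measurable d (T : measurableType d) (R : realType)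
    (mu : {measure set T -> \bar R}) (D : set T) (f g : T -> \bar R) :
  measurable D -> measurable_fun D f -> measurable_fun D g ->
  (forall x, D x -> f x <= g x)%E ->
  (\int[mu]_(x in D) f x <= \int[mu]_(x in D) g x)%E.
Proof.
move=> mD mf mg fg; rewrite integralE [leRHS]integralE leeB//.
- apply: ge0_le_integral => //; [exact: measurable_funepos..|].
  by move=> x /mem_set; apply: funepos_le => y /set_mem; exact: fg.
- apply: ge0_le_integral => //; [exact: measurable_funeneg..|].
  by move=> x /mem_set; apply: funeneg_le => y /set_mem; exact: fg.
Qed.

Lemma probability_setI_full d (T : measurableType d) (R : realType)
    (P : probability T R) (D B : set T) :
  measurable D -> measurable B -> P D = 1%E -> P (B `&` D) = P B.
Proof.
move=> mD mB PD.
have PC : P (~` D) = 0%E by rewrite probability_setC// PD subee.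
rewrite [RHS](measureDI P mB mD).
rewrite [X in (X + _)%E](_ : _ = 0%E) ?add0e//.
apply: (@subset_measure0 _ _ _ P _ (~` D)) => //.
- exact: measurableD.
- exact: measurableC.
Qed.

Section InvariantMeasure.
Variables (R : realType) (M : trans_matrix) (mu : probability PS R).
Hypothesis imu : invariant_prob M mu.

Let mS := measurable_Sigma M.
Let muS : mu (Sigma M : set PS) = 1%E. Proof. by case: imu. Qed.

Lemma mu_setC_Sigma : mu (~` Sigma M : set PS) = 0%E.
Proof. by rewrite probability_setC// muS subee. Qed.

Lemma integrable_ucont (f : (nat -> nat) -> R) K : ucont M f ->
  (forall x, Sigma M x -> `|f x| <= K) ->
  mu.-integrable (Sigma M : set PS) (EFin \o f).
Proof.
move=> cf fK; apply: measurable_bounded_integrable => //.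
- by suff : (mu (Sigma M : set PS) < +oo)%E by []; rewrite muS ltry.
- exact: measurable_ucont.
- exists K; split; first exact: num_real.
  by move=> r Kr x Mx; apply: le_trans (ltW Kr); exact: fK.
Qed.

Lemma integral_sshift (u : (nat -> nat) -> R) : ucont M u ->
  (forall x, Sigma M x -> 0 <= u x) ->
  (\int[mu]_(x in (Sigma M : set PS)) (u (sshift x))%:E =
   \int[mu]_(x in (Sigma M : set PS)) (u x)%:E)%E.
Proof.
move=> cu u0.
have mu' : measurable_fun (Sigma M : set PS) (fun x : PS => (u x)%:E).
  by apply/measurable_EFinP; exact: measurable_ucont.
have mpre : measurable (sshift @^-1` Sigma M : set PS).
  by rewrite -[X in measurable X]setTI; exact: measurable_sshift.
have <- : (\int[pushforward mu (sshift : PS -> PS)]_(x in (Sigma M : set PS))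
    (u x)%:E =
  \int[mu]_(x in (Sigma M : set PS)) (u x)%:E)%E.
  apply: eq_measure_integral => [|? B mB _]; first exact: measurable_sshift.
  by case: imu => _ /(_ _ mB).
rewrite ge0_integral_pushforward//; last first.
- by move=> x /set_mem Mx; rewrite lee_fin u0.
- exact: measurable_sshift.
rewrite (@ge0_negligible_integral _ _ _ mu _
  ((sshift @^-1` Sigma M) `\` Sigma M))//.
- congr integral; rewrite setDD; apply/seteqP; split=> [x Mx|x []//].
  by split=> //; exact: Sigma_sshift.
- exact: measurableD.
- apply: (measurable_comp mS) => //; first by move=> _ [x Mx <-].
  exact: measurable_funTS measurable_sshift.
- by move=> x Mx; rewrite lee_fin u0.
- apply: (@subset_measure0 _ _ _ mu _ (~` Sigma M)) => //.
  + exact: measurableD.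
  + exact: measurableC.
  + exact: mu_setC_Sigma.
Qed.

Lemma integral_coboundary (u : (nat -> nat) -> R) c K : ucont M u ->
  (forall x, Sigma M x -> 0 <= u x <= K) ->
  (\int[mu]_(x in (Sigma M : set PS)) (c + u (sshift x) - u x)%:E = c%:E)%E.
Proof.
move=> cu uK.
have iu : mu.-integrable (Sigma M : set PS) (EFin \o u).
  apply: (@integrable_ucont _ K) => // x Mx.
  by case/andP: (uK _ Mx) => u0 ?; rewrite ger0_norm.
have ius : mu.-integrable (Sigma M : set PS) (EFin \o (u \o sshift)).
  apply: (@integrable_ucont _ K); first exact: ucont_sshift.
  move=> x /Sigma_sshift Mx.
  by case/andP: (uK _ Mx) => u0 ?; rewrite ger0_norm.
have ic : mu.-integrable (Sigma M : set PS) (EFin \o cst c).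
  exact: finite_measure_integrable_cst.
have icu : mu.-integrable (Sigma M : set PS)
    (EFin \o (fun x => c + u (sshift x))).
  exact: (integrableD mS ic ius).
rewrite (eq_integral (fun x : PS => (c + u (sshift x))%:E - (u x)%:E)%E); last first.
  by move=> x _; rewrite EFinB.
rewrite (integralB_EFin mS icu iu).
rewrite (eq_integral (fun x : PS => c%:E + (u (sshift x))%:E)%E); last first.
  by move=> x _; rewrite EFinD.
rewrite (integralD_EFin mS ic ius) [X in (X + _ - _)%E](_ : _ = c%:E); last first.
  transitivity (c%:E * mu (Sigma M : set PS))%E; last by rewrite muS mule1.
  exact: (integral_cst mu mS c%:E).
rewrite [X in (_ + X - _)%E](integral_sshift cu).
  by rewrite addeK//; exact: (integrable_fin_num mS iu).
by move=> x Mx; case/andP: (uK _ Mx).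
Qed.

Lemma mu_setI_Sigma (B : set PS) : measurable B -> mu (B `&` Sigma M) = mu B.
Proof. by move=> mB; exact: probability_setI_full. Qed.

Lemma intA_le (A u : (nat -> nat) -> R) c K e (B : set PS) :
  ucont M A -> ucont M u -> (forall x, Sigma M x -> 0 <= u x <= K) ->
  measurable B ->
  (forall x, Sigma M x -> A x + e * \1_B x <= c + u (sshift x) - u x) ->
  (intA M A mu <= c%:E - e%:E * mu B)%E.
Proof.
move=> cA cu uK mB AB.
pose v x := c + u (sshift x) - u x.
have cv : ucont M v.
  apply: ucontD; last exact: ucontN.
  by apply: ucontD; [exact: ucont_cst|exact: ucont_sshift].
have iv : mu.-integrable (Sigma M : set PS) (EFin \o v).
  apply: (@integrable_ucont _ (`|c| + K)) => // x Mx.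
  have /andP[? ?] := uK _ Mx; have /andP[? ?] := uK _ (Sigma_sshift Mx).
  rewrite /v -addrA (le_trans (ler_normD _ _))// lerD2l ler_norml; lra.
have iB : mu.-integrable (Sigma M : set PS) (fun x => (\1_B x)%:E).
  by apply: (@integrableS _ _ _ _ setT) => //; exact: integrable_indic.
have ieB : mu.-integrable (Sigma M : set PS) (EFin \o (fun x => e * \1_B x)).
  exact: (integrableZl mS e iB).
apply: (@le_trans _ _
  (\int[mu]_(x in (Sigma M : set PS)) ((v x)%:E - (e * \1_B x)%:E))%E).
  apply: le_integral_measurable => //.
  - by apply/measurable_EFinP; exact: measurable_ucont.
  - exact: measurable_int (integrableB mS iv ieB).
  - by move=> x Mx; rewrite -EFinB lee_fin lerBrDr; exact: AB.
rewrite (integralB_EFin mS iv ieB) (integral_coboundary _ cu uK).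
rewrite (eq_integral (fun x : PS => e%:E * (\1_B x)%:E)%E); last first.
  by move=> x _; rewrite EFinM.
by rewrite integralZl// integral_indic// -(mu_setI_Sigma mB).
Qed.

Lemma supp_Sigma : supp mu `<=` Sigma M.
Proof.
move=> x sx; apply: contrapT => /Sigma_setC_open[k kM].
have := sx k; suff -> : mu (cyl x k : set PS) = 0%E by rewrite ltxx.
apply: (@subset_measure0 _ _ _ mu _ (~` Sigma M)) => //.
- exact: measurable_cyl.
- exact: measurableC.
- exact: mu_setC_Sigma.
Qed.

Lemma supp_sh k x : supp mu x -> supp mu (sh k x).
Proof.
elim: k x => // k IH x sx.
apply: (IH (sshift x)) => m.
have [_ inv] := imu; rewrite -inv; last exact: measurable_cyl.
apply: lt_le_trans (sx m.+1) _; apply: le_measure; rewrite ?inE.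
- exact: measurable_cyl.
- rewrite -[X in measurable X]setTI; apply: measurable_sshift => //.
  exact: measurable_cyl.
- by move=> y yx j jm; rewrite /sshift yx.
Qed.

Lemma supp_contact (A u g : (nat -> nat) -> R) c K :
  ucont M A -> ucont M u -> (forall x, Sigma M x -> 0 <= u x <= K) ->
  (forall x, g x = c - A x - u x + u (sshift x)) ->
  (forall x, Sigma M x -> 0 <= g x) ->
  intA M A mu = c%:E -> supp mu `<=` contact M g.
Proof.
move=> cA cu uK gE g0 Ac x sx; have Mx := supp_Sigma sx; split=> // k.
have cg : ucont M g.
  rewrite (_ : g = fun x => c + - A x + - u x + u (sshift x)); last exact/funext.
  apply: ucontD; last exact: ucont_sshift.
  apply: ucontD; last exact: ucontN.
  by apply: ucontD; [exact: ucont_cst|exact: ucontN].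
apply: contrapT => /eqP gk; have {gk} : 0 < g (sh k x).
  by rewrite lt_neqAle eq_sym gk g0//; exact: Sigma_sh.
set e := g (sh k x) => e0; have e2 : 0 < e / 2 by rewrite divr_gt0.
have [m Hm] := cg _ e2.
have mB : measurable (cyl (sh k x) m : set PS) by exact: measurable_cyl.
have := @intA_le A u c K (e / 2) _ cA cu uK mB.
rewrite Ac -(@fineK _ (mu _)) ?fin_num_measure// -EFinM -EFinB lee_fin.
have muB : 0 < fine (mu (cyl (sh k x) m : set PS)).
  rewrite -lte_fin fineK ?fin_num_measure//; exact: supp_sh.
have /[swap]/[apply] : forall y, Sigma M y ->
    A y + e / 2 * \1_(cyl (sh k x) m) y <= c + u (sshift y) - u y.
  move=> y My; have := g0 _ My; rewrite indicE.
  have [xy|xy] := pselect (cyl (sh k x) m y); last first.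
    by rewrite memNset//= gE; lra.
  rewrite mem_set//=; have := Hm _ _ (Sigma_sh k Mx) My (agree_sym xy).
  by rewrite -/e gE; lra.
have := mulr_gt0 e2 muB; lra.
Qed.

End InvariantMeasure.

Lemma negligible_setC_supp {R : realType} (mu : probability PS R) :
  mu.-negligible (~` supp mu : set PS).
Proof.
pose F n : set PS := if unpickle n is Some s then
  if `[< mu (cyl (nth 0%N s) (size s) : set PS) = 0%E >]
  then cyl (nth 0%N s) (size s) else set0 else set0.
apply: (@negligibleS _ _ _ _ (\bigcup_k F k)); last first.
  apply: negligible_bigcup => k; rewrite /F.
  case: unpickle => [s|]; last exact: negligible_set0.
  case: asboolP => [mu0|_]; last exact: negligible_set0.
  by apply/negligibleP => //; exact: measurable_cyl.
move=> x; rewrite /supp /= => /existsNP[k kx].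
have mu0 : mu (cyl x k : set PS) = 0%E.
  by apply/eqP; rewrite eq_le measure_ge0 andbT leNgt; exact/negP.
exists (pickle (mkseq x k)) => //; rewrite /F pickleK size_mkseq cyl_prefix.
by case: asboolP => // _; exact: cyl_self.
Qed.

Lemma intA_supp_contact {R : realType} M (mu : probability PS R)
    (A u g : (nat -> nat) -> R) c K :
  invariant_prob M mu -> ucont M A -> ucont M u ->
  (forall x, Sigma M x -> 0 <= u x <= K) ->
  (forall x, g x = c - A x - u x + u (sshift x)) ->
  supp mu `<=` contact M g -> intA M A mu = c%:E.
Proof.
move=> imu cA cu uK gE sg.
rewrite -(integral_coboundary imu c cu uK).
apply: ae_eq_integral.
- exact: measurable_Sigma.
- by apply/measurable_EFinP; exact: measurable_ucont.
- apply/measurable_EFinP; apply: measurable_ucont.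
  apply: ucontD; last exact: ucontN.
  by apply: ucontD; [exact: ucont_cst|exact: ucont_sshift].
- suff : mu.-negligible (~` [set x : PS | Sigma M x ->
      (A x)%:E = (c + u (sshift x) - u x)%:E]) by [].
  apply: negligibleS (negligible_setC_supp mu) => x /= + sx; apply => Mx.
  have [_ /(_ 0%N)] := sg _ sx.
  rewrite sh0 gE => gx; congr (_ %:E); lra.
Qed.

(** * Invariant measures carried by an orbit closure *)

Lemma ler_sum_prefix (R : realType) (f : nat -> R) a b :
  (forall i, 0 <= f i) -> (a <= b)%N ->
  \sum_(i < a) f i <= \sum_(i < b) f i.
Proof.
move=> f0 ab; rewrite -(subnKC ab) big_split_ord /= lerDl.
by apply: sumr_ge0 => i _.
Qed.

Lemma uniform_prob_itvco (R : realType) (a b : R) : a <= b ->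
  `[a, b[ `<=` `[0, 1] ->
  uniform_prob (@ltr01 R) `[a, b[%classic = (b - a)%:E.
Proof.
move=> ab ab01; rewrite /uniform_prob.
rewrite (eq_integral (cst 1%E)); last first.
  move=> x /set_mem /ab01; rewrite /= in_itv/= /uniform_pdf => ->.
  by rewrite subr0 invr1.
rewrite integral_cst//= mul1e lebesgue_measure_itv/= lte_fin.
by case: ltgtP ab => // -> _; rewrite subrr.
Qed.

(* Cylinder weights cut [0, 1[ into nested half-open intervals, one per word, in
   lexicographic order.  Reading off the word of t is a measurable map under
   which Lebesgue measure gives each cylinder its weight: the alphabet bound
   replaces the usual extension theorem. *)
Section Coding.
Variables (R : realType) (m : seq nat -> R) (I : nat).
Hypotheses (m_nil : m [::] = 1) (m_ge0 : forall s, 0 <= m s)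
  (m_split : forall s, m s = \sum_(a < I.+1) m (rcons s a))
  (m_out : forall s a, (I < a)%N -> m (rcons s a) = 0).

Definition left_end (s : seq nat) : R :=
  \sum_(i < size s) \sum_(b < nth 0%N s i) m (rcons (take i s) b).

Lemma left_end_rcons s a :
  left_end (rcons s a) = left_end s + \sum_(b < a) m (rcons s b).
Proof.
rewrite /left_end size_rcons big_ord_recr /=; congr (_ + _).
  apply: eq_bigr => i _; rewrite nth_rcons ltn_ord -cats1 takel_cat//.
  exact: ltnW.
by rewrite nth_rcons ltnn eqxx -cats1 take_size_cat.
Qed.

Definition in_word s t := left_end s <= t < left_end s + m s.

Definition next_letter s t : nat :=
  find (fun a => t < left_end s + \sum_(b < a.+1) m (rcons s b)) (iota 0 I.+1).

Lemma in_word_next s t : in_word s t -> in_word (rcons s (next_letter s t)) t.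
Proof.
move=> /andP[st ts]; rewrite /in_word left_end_rcons.
set p := fun a => t < left_end s + \sum_(b < a.+1) m (rcons s b).
have hp : has p (iota 0 I.+1).
  by apply/hasP; exists I; rewrite ?mem_iota//= /p -m_split.
have := hp; rewrite has_find size_iota => nI.
apply/andP; split; last first.
  have := nth_find 0%N hp; rewrite nth_iota// add0n /p big_ord_recr /=.
  by rewrite addrA.
have : forall b, (b < next_letter s t)%N -> ~~ p b.
  move=> b bn; have := before_find 0%N bn.
  by rewrite nth_iota ?add0n /p => [->//|]; exact: ltn_trans nI.
case: (next_letter s t) => [_|b /(_ b (ltnSn b))]; first by rewrite big_ord0 addr0.
by rewrite /p -leNgt.
Qed.

Lemma in_word_rcons s a t : in_word (rcons s a) t ->
  in_word s t /\ next_letter s t = a.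
Proof.
move=> /andP[at1 at2]; have aI : (a < I.+1)%N.
  rewrite ltnS leqNgt; apply/negP => /(m_out s) ma.
  by move: at2; rewrite ma addr0 ltNge at1.
have mono := @ler_sum_prefix R (fun b => m (rcons s b)) _ _
  (fun b => m_ge0 (rcons s b)).
have at2' : t < left_end s + \sum_(b < a.+1) m (rcons s b).
  by rewrite big_ord_recr /= addrA -left_end_rcons.
have sw : in_word s t.
  apply/andP; split.
    by apply: le_trans at1; rewrite left_end_rcons lerDl sumr_ge0.
  by apply: lt_le_trans at2' _; rewrite lerD2l [leRHS]m_split mono.
split=> //; have /andP[] := in_word_next sw; set a' := next_letter s t => n1 n2.
have n2' : t < left_end s + \sum_(b < a'.+1) m (rcons s b).
  by rewrite big_ord_recr /= addrA -left_end_rcons.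
move: at1 n1; rewrite !left_end_rcons => at1 n1.
apply/eqP; rewrite eqn_leq; apply/andP; split; rewrite leqNgt; apply/negP.
  move=> /mono h; have := lt_le_trans at2' (lerD (lexx (left_end s)) h).
  by rewrite ltNge n1.
move=> /mono h; have := lt_le_trans n2' (lerD (lexx (left_end s)) h).
by rewrite ltNge at1.
Qed.

Fixpoint coded_prefix n t : seq nat :=
  if n is n'.+1 then rcons (coded_prefix n' t) (next_letter (coded_prefix n' t) t)
  else [::].

Lemma size_coded_prefix n t : size (coded_prefix n t) = n.
Proof. by elim: n => //= n IH; rewrite size_rcons IH. Qed.

Lemma in_word_nil t : in_word [::] t = (0 <= t < 1).
Proof. by rewrite /in_word /left_end big_ord0 add0r m_nil. Qed.

Lemma in_word_coded_prefix n t : 0 <= t < 1 -> in_word (coded_prefix n t) t.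
Proof.
move=> t01; elim: n => [|n IH]; first by rewrite in_word_nil.
exact: in_word_next.
Qed.

Lemma coded_prefix_in_word s t : in_word s t ->
  0 <= t < 1 /\ coded_prefix (size s) t = s.
Proof.
elim/last_ind: s => [|s a IH]; first by rewrite in_word_nil.
by move=> /in_word_rcons[/IH[t01 ps] na]; rewrite size_rcons /= ps na.
Qed.

Definition code (t : R) : nat -> nat :=
  if 0 <= t < 1 then fun i => nth 0%N (coded_prefix i.+1 t) i else fun=> 0%N.

Lemma mkseq_code n t : 0 <= t < 1 -> mkseq (code t) n = coded_prefix n t.
Proof.
move=> t01; elim: n => // n IH; rewrite mkseqS IH /= /code t01 /=.
by rewrite nth_rcons size_coded_prefix ltnn eqxx.
Qed.

Lemma cyl_mkseq x y k : cyl x k y <-> mkseq y k = mkseq x k.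
Proof.
split=> [xy|E j jk].
  apply: (@eq_from_nth _ 0%N); rewrite !size_mkseq// => i ik.
  by rewrite !nth_mkseq// xy.
by rewrite -(nth_mkseq 0%N y jk) E nth_mkseq.
Qed.

Lemma code_preimage_cyl x k :
  (code @^-1` cyl x k) `&` `[0, 1[%classic =
  `[left_end (mkseq x k), left_end (mkseq x k) + m (mkseq x k)[%classic.
Proof.
apply/seteqP; split=> t.
  move=> [/= /cyl_mkseq xt]; rewrite !in_itv /= => t01.
  by rewrite mkseq_code// in xt; rewrite -xt; exact: in_word_coded_prefix.
rewrite /= !in_itv /= => /coded_prefix_in_word[t01 pt]; split=> //.
by apply/cyl_mkseq; rewrite mkseq_code// -[in LHS](size_mkseq x k).
Qed.

Lemma measurable_code : measurable_fun [set: measurableTypeR R]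
  (code : measurableTypeR R -> PS).
Proof.
apply: (@measurability _ _ (measurableTypeR R) PS _ _ cylinders) => //.
move=> _ [_ [x [k ->]] <-]; rewrite setTI.
rewrite -(setUIDK (code @^-1` cyl x k) `[0, 1[%classic) code_preimage_cyl.
apply: measurableU; first exact: measurable_itv.
have [x0|x0] := pselect (cyl x k (fun=> 0%N)).
  rewrite (_ : _ `\` _ = ~` `[0, 1[%classic).
    by apply: measurableC; exact: measurable_itv.
  apply/seteqP; split=> [t []//|t nt]; split=> //.
  by move: nt; rewrite /= in_itv /= /code => /negP/negbTE ->.
rewrite (_ : _ `\` _ = set0); first exact: measurable0.
apply/seteqP; split=> // t [/= + /negP]; rewrite in_itv /= /code.
by move=> + /negbTE nt; rewrite nt.
Qed.

Lemma coded_probability : exists mu : probability PS R,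
  forall x k, mu (cyl x k : set PS) = (m (mkseq x k))%:E.
Proof.
pose X : {mfun measurableTypeR R >-> PS} :=
  HB.pack (code : measurableTypeR R -> PS)
    (isMeasurableFun.Build _ _ _ _ (code : measurableTypeR R -> PS)
      measurable_code).
pose P : probability (measurableTypeR R) R := uniform_prob (@ltr01 R).
exists (distribution P X) => x k.
have P01 : P `[0, 1[%classic = 1%E.
  transitivity (1 - 0 : R)%:E; last by rewrite subr0.
  apply: uniform_prob_itvco => // t /=.
  by rewrite !in_itv/= => /andP[-> /ltW].
pose Y : set (measurableTypeR R) := code @^-1` cyl x k.
have mY : measurable Y.
  rewrite -[X in measurable X]setTI; apply: measurable_code => //.
  exact: measurable_cyl.
have PY : P (Y `&` (`[0, 1[%classic : set (measurableTypeR R))) = P Y.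
  by apply: probability_setI_full => //; exact: measurable_itv.
transitivity (P Y) => //; rewrite -PY /Y code_preimage_cyl.
set a := left_end _; transitivity (a + m (mkseq x k) - a)%:E; last first.
  by rewrite addrAC subrr add0r.
apply: uniform_prob_itvco; first by rewrite lerDl.
by rewrite -code_preimage_cyl => t [_ /=]; rewrite !in_itv/= => /andP[-> /ltW].
Qed.

End Coding.

Lemma ultra_fmap (T V : Type) (f : T -> V) (U : set_system T) :
  UltraFilter U -> UltraFilter [set B | U (f @^-1` B)].
Proof.
move=> UU; split; first exact: fmap_proper_filter.
move=> G GF sG; apply/seteqP; split=> B; last exact: sG.
move=> GB; have [//|UnB] := in_ultra_setVsetC (f @^-1` B) UU.
have /filter_ex[y []//] : G (B `&` ~` B) by apply: filterI => //; exact: sG.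
Qed.

Lemma ultra_cvg_unit (R : realType) (U : set_system nat) (f : nat -> R) :
  UltraFilter U -> (forall n, 0 <= f n <= 1) ->
  exists l : R, 0 <= l /\ f @ U --> l.
Proof.
move=> UU f01; have UfU := ultra_fmap f UU.
have := @segment_compact R 0 1; rewrite compact_ultra => /(_ _ UfU)[].
  suff : U (f @^-1` `[0, 1]%classic) by [].
  by apply: filterE => n; rewrite /= in_itv/= f01.
by move=> l [/=]; rewrite in_itv/= => /andP[l0 _] fl; exists l.
Qed.

Lemma indic_preimage (R : realType) (T V : Type) (f : T -> V) (B : set V) x :
  \1_(f @^-1` B) x = \1_B (f x) :> R.
Proof.
by rewrite !indicE; congr (_%:R); congr nat_of_bool.
Qed.

Lemma cvg_bigsum (R : realType) (T J : Type) (U : set_system T) (r : seq J)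
    (f : J -> T -> R) (l : J -> R) : Filter U ->
  (forall j, f j t @[t --> U] --> l j) ->
  \sum_(j <- r) f j t @[t --> U] --> \sum_(j <- r) l j.
Proof.
move=> FU fl; elim: r => [|j r IH].
  by rewrite big_nil; under eq_fun do rewrite big_nil; exact: cvg_cst.
rewrite big_cons; under eq_fun do rewrite big_cons.
exact: cvgD.
Qed.

(* Limits along an ultrafilter give every subset, measurable or not, a
   frequency along the orbit of z. *)
Lemma orbit_frequency (R : realType) (z : nat -> nat) :
  exists nu : set (nat -> nat) -> R, [/\ nu setT = 1, forall B, 0 <= nu B,
    forall n B (F : 'I_n -> set (nat -> nat)),
      (forall k, \1_B (sh k z) = \sum_(i < n) \1_(F i) (sh k z) :> R) ->
      nu B = \sum_(i < n) nu (F i) &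
    forall B, nu (sshift @^-1` B) = nu B].
Proof.
have [U [UU ooU]] := ultraFilterLemma eventually_filter.
pose S n (B : set (nat -> nat)) : R := \sum_(k < n.+1) \1_B (sh k z).
pose freq n B : R := S n B / n.+1%:R.
have indic01 (B : set (nat -> nat)) x : 0 <= (\1_B x : R) <= 1.
  by rewrite indicE; case: (_ \in _); rewrite ?lexx ?ler01.
have freq01 n B : 0 <= freq n B <= 1.
  apply/andP; split.
    by rewrite divr_ge0// sumr_ge0// => i _; case/andP: (indic01 B (sh i z)).
  rewrite ler_pdivrMr ?ltr0n// mul1r -[n.+1 in leRHS]card_ord -sumr_const.
  by apply: ler_sum => i _; case/andP: (indic01 B (sh i z)).
have /choice[nu Hnu] : forall B, exists l : R, 0 <= l /\ freq n B @[n --> U] --> l.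
  by move=> B; apply: ultra_cvg_unit.
have uniq (f : nat -> R) (l l' : R) : f @ U --> l -> f @ U --> l' -> l = l'.
  exact: (cvg_unique (@norm_hausdorff _ _)).
exists nu; split.
- apply: (uniq (freq ^~ setT)); first by case: (Hnu setT).
  rewrite (_ : (fun n => _) = cst 1); first exact: cvg_cst.
  apply/funext => n; rewrite /freq /S.
  under eq_bigr do rewrite indicT.
  by rewrite sumr_const card_ord divff// pnatr_eq0.
- by move=> B; case: (Hnu B).
- move=> N B F BF; apply: (uniq (freq ^~ B)); first by case: (Hnu B).
  rewrite (_ : (fun n => _) = fun n => \sum_(i < N) freq n (F i)).
    by apply: cvg_bigsum => i; case: (Hnu (F i)).
  apply/funext => n; rewrite /freq -mulr_suml /S exchange_big /=.
  by congr (_ / _); apply: eq_bigr => k _.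
- move=> B; apply/eqP; rewrite -subr_eq0; apply/eqP.
  apply: (uniq (fun n => freq n (sshift @^-1` B) - freq n B)).
    by apply: cvgB; [case: (Hnu (sshift @^-1` B))|case: (Hnu B)].
  apply/cvgrPdist_lt => e e0.
  have : U [set n : nat | n.+1%:R^-1 < e].
    by apply: ooU; exact: (near_infty_natSinv_lt (PosNum e0)).
  apply: filterS => n /=; apply: le_lt_trans.
  have -> : freq n (sshift @^-1` B) - freq n B =
      (\1_B (sh n.+1 z) - \1_B z) / n.+1%:R.
    rewrite /freq -mulrBl /S; congr (_ / _).
    under eq_bigr do rewrite indic_preimage sshift_sh.
    rewrite big_ord_recr [X in _ - X]big_ord_recl /= sh0.
    by set s := \sum_(i < n) _; rewrite -[X in _ - (_ + X)]/s; lra.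
  rewrite sub0r normrN normrM normfV [`|_.+1%:R|]ger0_norm// ler_piMl//.
  have := indic01 B (sh n.+1 z); have := indic01 B z.
  by move=> /andP[? ?] /andP[? ?]; rewrite ler_norml; apply/andP; split; lra.
Qed.

Lemma cyl_nthE s x : cyl (nth 0%N s) (size s) x <-> mkseq x (size s) = s.
Proof. by rewrite cyl_mkseq mkseq_nth. Qed.

Lemma indic_cyl_nth (R : realType) s x :
  \1_(cyl (nth 0%N s) (size s)) x = (mkseq x (size s) == s)%:R :> R.
Proof.
rewrite indicE; congr (_%:R); congr nat_of_bool.
by apply/idP/eqP => [/set_mem/cyl_nthE|/cyl_nthE/mem_set].
Qed.

Lemma sum_letter (R : realType) I y (b : bool) : (y <= I)%N ->
  \sum_(a < I.+1) ((y == a :> nat) && b)%:R = b%:R :> R.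
Proof.
move=> yI; rewrite (bigD1 (Ordinal (yI : (y < I.+1)%N)))//= eqxx /=.
rewrite big1 ?addr0// => i /eqP iy.
case: eqP => // yi; case: iy; exact/val_inj.
Qed.

Lemma mkseq_cons x n : mkseq x n.+1 = x 0%N :: mkseq (sshift x) n.
Proof. by rewrite /mkseq /= (iotaDl 1 0 n) -map_comp. Qed.

Lemma probability_letter_split (R : realType) (mu : probability PS R) I
    (B : set PS) : measurable B ->
  \sum_(a < I.+1) mu (cyl (fun=> a : nat) 1 : set PS) = 1%E ->
  mu B = \sum_(a < I.+1) mu (B `&` cyl (fun=> a : nat) 1 : set PS).
Proof.
move=> mB mu1; pose F (a : nat) : set PS := cyl (fun=> a) 1.
have mF a : measurable (F a) by exact: measurable_cyl.
have tF : trivIset setT F.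
  by move=> a b _ _ [x [/(_ 0%N isT) <- /(_ 0%N isT) <-]].
have muF : mu (\big[setU/set0]_(a < I.+1) F a) = 1%E by rewrite measure_bigsetU.
rewrite -(probability_setI_full (bigsetU_measurable _ _) mB muF)//.
rewrite big_distrr /= (measure_bigsetU mu (F := fun a => B `&` F a))//.
  by move=> a; exact: measurableI.
exact: trivIset_setIl.
Qed.

Lemma invariant_of_cylinders (R : realType) (mu : probability PS R) :
  (forall s, mu (sshift @^-1` cyl (nth 0%N s) (size s) : set PS) =
             mu (cyl (nth 0%N s) (size s) : set PS)) ->
  forall B : set PS, measurable B -> mu (sshift @^-1` B) = mu B.
Proof.
move=> inv B mB; pose G : set (set PS) := cylinders `|` [set set0].
have mG : measurable = <<s G >>.
  apply/seteqP; split; apply: smallest_sub; try exact: smallest_sigma_algebra.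
    by move=> C cC; apply: sub_sigma_algebra; left.
  move=> C [cC|->]; [exact: sub_sigma_algebra|exact: measurable0].
have := @measure_unique _ R PS G (fun=> setT) mG _ _ _
  (pushforward mu (sshift : PS -> PS)) mu _ _ B mB.
apply => //.
- move=> C D [[x [k ->]]|->]; last by move=> _; right; rewrite set0I.
  move=> [[y [l ->]]|->]; last by right; rewrite setI0.
  have [[z [xz yz]]|no] := pselect ((cyl x k `&` cyl y l) !=set0); last first.
    by right; apply/seteqP; split=> // z hz; case: no; exists z.
  left; exists z, (maxn k l); apply/seteqP; split=> w.
    move=> [xw yw] j; rewrite leq_max => /orP[jk|jl].
      by rewrite xw// xz.
    by rewrite yw// yz.
  move=> zw; split=> j jm; rewrite zw ?leq_max ?jm ?orbT//; first exact: xz.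
  exact: yz.
- by move=> _; left; exists (fun=> 0%N), 0%N; apply/seteqP; split.
- by rewrite bigcup_const.
- exact: measurable_sshift.
- move=> ms C [[x [k ->]]|->]; last by rewrite !measure0.
  by rewrite /pushforward; have := inv (mkseq x k); rewrite size_mkseq cyl_prefix.
- by move=> ms _; have := ltry (1 : R); rewrite -(probability_setT mu).
Qed.

Lemma orbit_measure (R : realType) (z : nat -> nat) I : (forall j, (z j <= I)%N) ->
  exists mu : probability PS R,
    (forall B : set PS, measurable B -> mu (sshift @^-1` B) = mu B) /\
    (forall x, supp mu x -> forall k, exists j, agree k (sh j z) x).
Proof.
move=> zI; have [nu [nuT nu0 nu_sum nu_shift]] := orbit_frequency R z.
pose m s := nu (cyl (nth 0%N s) (size s)).
have zIk k j : (sh k z j <= I)%N by exact: zI.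
have m_nil : m [::] = 1.
  by rewrite /m (_ : cyl _ _ = setT)//; apply/seteqP; split.
have m_split s : m s = \sum_(a < I.+1) m (rcons s a).
  apply: nu_sum => k; rewrite indic_cyl_nth.
  under eq_bigr do rewrite indic_cyl_nth size_rcons mkseqS eqseq_rcons andbC.
  by rewrite sum_letter.
have m_cons s : m s = \sum_(a < I.+1) m ((a : nat) :: s).
  rewrite /m -nu_shift; apply: nu_sum => k.
  under eq_bigr do rewrite indic_cyl_nth /= mkseq_cons eqseq_cons.
  by rewrite sum_letter// -indic_cyl_nth.
have m_none s : (forall k, mkseq (sh k z) (size s) <> s) -> m s = 0.
  move=> no; rewrite /m (nu_sum 0%N _ (fun=> setT)) ?big_ord0// => k.
  by rewrite big_ord0 indic_cyl_nth; case: eqP (no k).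
have m_out s a : (I < a)%N -> m (rcons s a) = 0.
  move=> Ia; apply: m_none => k; rewrite size_rcons mkseqS => /rcons_inj[_ ka].
  by have := zIk k (size s); rewrite ka leqNgt Ia.
have [mu muE] := coded_probability m_nil (fun s => nu0 _) m_split m_out.
exists mu; split; last first.
  move=> x sx k; apply: contrapT => no; have := sx k; rewrite muE m_none ?ltxx//.
  move=> j; rewrite size_mkseq => /cyl_mkseq jx; apply: no; exists j.
  exact: jx.
have letters : \sum_(a < I.+1) mu (cyl (fun=> a : nat) 1 : set PS) = 1%E.
  rewrite -m_nil m_split -sumEFin; apply: eq_bigr => a _; exact: muE.
apply: invariant_of_cylinders => s.
have mpre : measurable (sshift @^-1` cyl (nth 0%N s) (size s) : set PS).
  rewrite -[X in measurable X]setTI; apply: measurable_sshift => //.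
  exact: measurable_cyl.
rewrite (probability_letter_split mpre letters) muE mkseq_nth m_cons -sumEFin.
apply: eq_bigr => a _.
have -> : (sshift @^-1` cyl (nth 0%N s) (size s)) `&` cyl (fun=> a : nat) 1 =
    cyl (nth 0%N ((a : nat) :: s)) (size s).+1.
  apply/seteqP; split=> [x [xs xa] [|j] js /=|x xas].
  - exact: xa.
  - exact: xs.
  - by split=> [j js|[|//] _]; [exact: (xas j.+1)|exact: (xas 0%N)].
by rewrite muE -[(size s).+1]/(size ((a : nat) :: s)) mkseq_nth.
Qed.

Lemma contact_sh {R : realType} M (g : (nat -> nat) -> R) k x :
  contact M g x -> contact M g (sh k x).
Proof. by elim: k x => // k IH x /contact_sshift/IH. Qed.

Unset Implicit Arguments.

Theorem mainTheorem1 (R : realType) (M : trans_matrix) (F : seq nat) (K0 : nat)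
  (lambda : R) (A : (nat -> nat) -> R) :
  0 < lambda < 1 ->
  finitely_primitive_with M F K0 ->
  Sigma M !=set0 ->
  bounded_above_on M A -> coercive M A -> locally_Holder M lambda A ->
  exists Ihat : nat, [/\ (I_F F < Ihat)%N,
    (exists mu0 : probability PS R,
        [/\ invariant_prob M mu0, supp mu0 `<=` SigmaI M Ihat &
            intA M A mu0 = betaA M A]),
    betaA M A = ereal_sup [set intA M A mu | mu in
        [set mu : probability PS R | invariant_prob M mu /\ supp mu `<=` SigmaI M Ihat]],
    (exists mu : probability PS R, maximizing M A mu) &
    exists Omega : set (nat -> nat),
      [/\ Omega `<=` SigmaI M Ihat, compact (Omega : set {ptws nat -> nat}),
          sshift @` Omega `<=` Omega &
          forall mu : probability PS R, invariant_prob M mu ->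
            (maximizing M A mu <-> supp mu `<=` Omega)]].
Proof.
move=> l01 fp S0 bnd coe hol; have [H [H0 varA]] := hol.
have [c [u [C [uC cu sub per]]]] := bounded_subaction_exists l01 fp S0 bnd H0 varA.
have cA := Holder_ucont l01 hol.
pose g x := c - A x - u x + u (sshift x).
have g0 x : Sigma M x -> 0 <= g x by move=> /sub; rewrite /g; lra.
have cg : ucont M g.
  apply: (ucontD (f := fun x => c - A x - u x)); last exact: ucont_sshift.
  apply: (ucontD (f := fun x => c - A x)); last exact: ucontN.
  by apply: (ucontD (f := fun=> c)); [exact: ucont_cst|exact: ucontN].
have [N HN] := coe (c - C - 1).
pose I := maxn N (I_F F).+1.
have gI x : Sigma M x -> g x < 1 -> (x 0%N <= I)%N.
  move=> Mx gx; rewrite leq_max; apply/orP; left; rewrite leqNgt; apply/negP.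
  move=> /ltnW Nx; have := HN _ Nx x Mx erefl; move: gx; rewrite /g.
  have /andP[? ?] := uC _ Mx; have /andP[? ?] := uC _ (Sigma_sshift Mx); lra.
have [z Oz] : contact M g !=set0.
  apply: (contact_nonempty cg g0 gI) => n e e0.
  have [p [q [q0 Mp pq hp]]] := per (e / n.+1%:R) (divr_gt0 e0 (ltr0Sn _ n)).
  apply: (small_run (n := q) (p := p)) => //.
  rewrite (_ : birk g q p = q%:R * c - birk A q p)//.
  by rewrite [LHS](birk_cobound A u c) pq subrK.
have [Mz zI] := contact_SigmaI gI Oz.
have [mu0 [inv0 near0]] := orbit_measure R zI.
have supp0 : supp mu0 `<=` contact M g.
  move=> x /near0 xz; apply: (contact_closed cg g0) => k.
  by have [j jx] := xz k; exists (sh j z); split=> //; exact: contact_sh.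
have imu0 : invariant_prob M mu0.
  split=> //; have mS := measurable_Sigma M.
  have null : mu0 (~` Sigma M : set PS) = 0%E.
    apply/negligibleP; first exact: measurableC.
    apply: negligibleS (negligible_setC_supp mu0).
    by apply: subsetC => x /supp0[].
  by rewrite -[Sigma M]setCK probability_setC ?null ?sube0//; exact: measurableC.
have betaE : betaA M A = c%:E.
  apply/eqP; rewrite eq_le; apply/andP; split.
    apply: ge_ereal_sup => _ [mu imu <-].
    have := @intA_le R M mu imu A u c C 0 set0 cA cu uC measurable0.
    rewrite mul0e sube0; apply => x Mx; rewrite mul0r addr0.
    by have := sub _ Mx; lra.
  apply: ereal_sup_ubound; exists mu0 => //.
  exact: (intA_supp_contact imu0 cA cu uC _ supp0).
have maxE mu : invariant_prob M mu ->
    (maximizing M A mu <-> supp mu `<=` contact M g).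
  move=> imu; split=> [[_ mumax]|smu].
    by apply: (supp_contact imu cA cu uC) => //; rewrite mumax.
  by split=> //; rewrite betaE; exact: (intA_supp_contact imu cA cu uC _ smu).
have max0 : maximizing M A mu0 by apply/maxE.
have supp0I : supp mu0 `<=` SigmaI M I.
  by apply: subset_trans supp0 _; exact: contact_SigmaI.
exists I; split.
- by rewrite leq_max leqnn orbT.
- by exists mu0; split=> //; case: max0.
- apply/eqP; rewrite eq_le; apply/andP; split.
    by rewrite -(max0.2); apply: ereal_sup_ubound; exists mu0.
  by apply: le_ereal_sup => _ [mu [imu _] <-]; exists mu.
- by exists mu0.
- exists (contact M g); split=> //.
  + exact: contact_SigmaI.
  + exact: (contact_compact cg g0 gI).
  + by move=> _ [x Ox <-]; exact: contact_sshift.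
Qed.
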